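(* Let $\mathcal E: q\mapsto\phi_q$ ($q\in Q$) be a modalised system of equations, and let $\mathcal F$ be the substitution $q\mapsto\digamma_{\!q}\,\mathcal E$ ($q\in Q$). Then $\mathcal F$ is a solution of $\mathcal E$: for each $q\in Q$, $\digamma_{\!q}\,\mathcal E\simeq\phi_q\mathcal F$, and no variable of $Q$ occurs in any $\digamma_{\!q}\,\mathcal E$.
   Context: Cyclic formulas. Labels: $\bot,\top$ and propositional variables (arity 0), $\neg,\Box$ (arity 1), $\wedge,\vee,\to$ (arity 2). A graph is $\langle V,r,S,\lambda\rangle$ with $V$ finite, root $r$, labelling $\lambda$, and $S:V\to V^{*}$ giving ordered successors (length = arity of label); every vertex reachable from $r$. A cycle is a set of pairwise distinct vertices $a_0,\dots,a_{k-1}$ with $a_{j+1}$ a successor of $a_j$ and $a_0$ a successor of $a_{k-1}$. A formula is a graph in which every cycle contains a $\Box$-labelled vertex. Bisimulation $R$: $aRa'$ implies equal labels and $i$-th successors related; $\phi\simeq\psi$ iff a bisimulation relates roots. $\langle\Psi\rangle_a$ is the subgraph generated by $a$. Simultaneous substitution $\phi\mathcal F$: disjoint union of $\phi$ and the $\mathcal F(q)$, identifying each $q$-labelled vertex of $\phi$ with the root of the copy of $\mathcal F(q)$ (keeping that root's label). $\phi$ is modalised in $p$ if every path from root to a $p$-labelled vertex contains a $\Box$-labelled vertex. A system of equations $\mathcal E$ maps a finite set $Q$ of variables to formulas $\phi_q$. ${\sf G}_{\mathcal E}$: directed graph on $Q$ with $q\to q'$ iff $\phi_q$ not modalised in $q'$;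 $\mathcal E$ is modalised iff ${\sf G}_{\mathcal E}$ is acyclic. ${\sf G}^\circ_{\mathcal E}$: $q\to q'$ iff the root of $\phi_q$ is labelled $q'$; ${\sf end}(q)$ = endpoint of the maximal path from $q$ in ${\sf G}^\circ_{\mathcal E}$. Unrooted graph $\Psi$: vertices $\langle\phi_q,a\rangle$ for $q\in Q$ and $a$ a vertex of $\phi_q$ whose label is not in $Q$; label $\lambda_{\phi_q}(a)$; ${\sf idfy}\langle\phi_q,a\rangle:=\langle\phi_{{\sf end}(q')},r_{\phi_{{\sf end}(q')}}\rangle$ if $a$ is labelled $q'\in Q$, else $\langle\phi_q,a\rangle$; if $S_{\phi_q}a=\langle b_0,\dots,b_{n-1}\rangle$ then $S_\Psi\langle\phi_q,a\rangle:=\langle{\sf idfy}\langle\phi_q,b_0\rangle,\dots,{\sf idfy}\langle\phi_q,b_{n-1}\rangle\rangle$; $\mathfrak r_q:={\sf idfy}\langle\phi_q,r_{\phi_q}\rangle$; $\digamma_{\!q}\,\mathcal E:=\langle\Psi\rangle_{\mathfrak r_q}$. *)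

(* Defs.v *)
From mathcomp Require Import all_boot finmap.

Set Implicit Arguments.
Unset Strict Implicit.
Unset Printing Implicit Defensive.

(* Any choiceType X may serve as the set of propositional variables. *)
Inductive label (X : Type) : Type :=
  | Bot | Top | Var of X | Neg | Box | And | Or | Imp.
Arguments Bot {X}.
Arguments Top {X}.
Arguments Neg {X}.
Arguments Box {X}.
Arguments And {X}.
Arguments Or {X}.
Arguments Imp {X}.

Definition arity (X : Type) (l : label X) : nat :=
  match l with
  | Bot | Top | Var _ => 0
  | Neg | Box => 1
  | And | Or | Imp => 2
  end.

Definition is_box (X : Type) (l : label X) : bool :=
  if l is Box then true else false.

Definition var_of (X : Type) (l : label X) : option X :=
  if l is Var p then Some p else None.

(* The element of Q, if any, that is the variable labelling a vertex. *)
Definition var_in (X : choiceType) (Q : {fset X}) (l : label X) : option Q :=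
  obind insub (var_of l).

(* For a duplicate-free c, [next c] maps each entry to the following one and
   the last entry to the first.  A single vertex with a loop is a cycle. *)
Definition is_cycle (T : eqType) (R : T -> T -> Prop) (c : seq T) : Prop :=
  [/\ c <> [::], uniq c & forall a, a \in c -> R a (next c a)].

Definition acyclic (T : eqType) (R : T -> T -> Prop) : Prop :=
  forall c, ~ is_cycle R c.

Record ugraph (X : Type) : Type := UGraph {
  vert :> finType;
  lab : vert -> label X;
  succ : vert -> seq vert;
  size_succ : forall a, size (succ a) = arity (lab a)
}.

Definition edge (X : Type) (G : ugraph X) : rel G :=
  fun a b => b \in succ a.

Record graph (X : Type) : Type := Graph {
  ugraph_of :> ugraph X;
  root : ugraph_of;
  root_reach : forall a, connect (@edge X ugraph_of) root a
}.

Definition guarded (X : Type) (G : ugraph X) : Prop :=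
  forall c, is_cycle (@edge X G) c -> has (fun a => is_box (lab a)) c.

Record formula (X : Type) : Type := Formula {
  graph_of :> graph X;
  formula_guarded : guarded graph_of
}.

Definition bisimulation (X : Type) (G H : ugraph X) (R : G -> H -> Prop) :
    Prop :=
  forall a a', R a a' ->
    lab a = lab a' /\
    forall i, i < arity (lab a) -> R (nth a (succ a) i) (nth a' (succ a') i).

Definition bisimilar (X : Type) (f g : formula X) : Prop :=
  exists2 R : f -> g -> Prop, bisimulation R & R (root f) (root g).

(* Paths are given by their first vertex and the list of the others; both ends
   count as lying on the path. *)
Definition modalised_in (X : Type) (f : graph X) (p : X) : Prop :=
  forall s : seq f,
    path (@edge X f) (root f) s -> lab (last (root f) s) = Var p ->
    has (fun a => is_box (lab a)) (root f :: s).

Definition bf (X : Type) (G : ugraph X) : rel G :=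
  fun a b => [&& ~~ is_box (lab a), ~~ is_box (lab b) & edge a b].

Lemma guardedP (X : Type) (G : ugraph X) :
  guarded G <-> (forall a b : G, bf a b -> ~ connect (@bf X G) b a).
Proof.
split=> [gG a b bab /connectP[p0]|H c [c0 Uc nc]].
  case/shortenP=> p pP Up _ defa.
  have cyc : cycle (@bf X G) (b :: p) by rewrite /= rcons_path pP -defa.
  have: has (fun a => is_box (lab a)) (b :: p).
    apply: gG; split=> // x xp.
    by case/and3P: (next_cycle cyc xp).
  case/hasP=> x xp; case/and3P: (next_cycle cyc xp) => + _ _.
  by move/negP.
apply/negPn/negP=> /hasPn hb.
case: c c0 Uc nc hb => // x c _ Uc nc hb.
have cyc : cycle (@bf X G) (x :: c).
  apply: cycle_from_next => // y yc.
  by rewrite /bf !hb ?mem_next //; apply: nc.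
move: cyc; rewrite /= rcons_path => /andP[pc lc].
by apply: (H _ _ lc); apply/connectP; exists c.
Qed.

Section Generated.
Context (X : Type) (G : ugraph X) (r : G).

Definition gen_vert : finType := {a : G | connect (@edge X G) r a}.

(* All successors of a reachable vertex are reachable, so pmap drops none. *)
Definition gen_succ (a : gen_vert) : seq gen_vert := pmap insub (succ (val a)).

Lemma map_gen_succ (a : gen_vert) : map val (gen_succ a) = succ (val a).
Proof.
rewrite /gen_succ pmap_filter; last exact: insubK.
apply/all_filterP/allP => b ab; rewrite insubT //.
by apply: connect_trans (valP a) (connect1 ab).
Qed.

Lemma gen_size_succ (a : gen_vert) :
  size (gen_succ a) = arity (lab (val a)).
Proof. by rewrite -size_succ -map_gen_succ size_map. Qed.

Definition gen_ugraph : ugraph X := UGraph gen_size_succ.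

Definition gen_root : gen_ugraph := exist _ r (connect0 _ r).

Lemma gen_edge (a b : gen_ugraph) : edge a b = edge (val a) (val b).
Proof.
by rewrite /edge -map_gen_succ mem_map //; apply: val_inj.
Qed.

Lemma gen_reach (a : gen_ugraph) : connect (@edge X gen_ugraph) gen_root a.
Proof.
case: a => a ra; have /connectP[p + la] := ra.
elim/last_ind: p a la ra => [|p b IHp] a.
  by move=> /= -> ra _; rewrite (_ : exist _ _ _ = gen_root) //; apply: val_inj.
rewrite last_rcons => -> rb; rewrite rcons_path => /andP[pp pb].
have rl : connect (@edge X G) r (last r p) by apply/connectP; exists p.
apply: connect_trans (IHp _ erefl rl pp) (connect1 _).
by rewrite gen_edge.
Qed.

Definition gen : graph X := Graph gen_reach.

Lemma gen_guarded : guarded G -> guarded gen.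
Proof.
move/guardedP=> gG; apply/guardedP => a b.
rewrite /bf gen_edge => ab /connectP[p pp la].
apply: (gG _ _ ab); apply/connectP; exists (map val p).
  elim: p b pp {la ab} => //= c p IHp b /andP[bc pc].
  by rewrite IHp // andbT; move: bc; rewrite /bf gen_edge.
by rewrite la last_map.
Qed.

End Generated.

Section Substitution.
Context (X : choiceType) (Q : {fset X}) (f : formula X) (F : Q -> formula X).

Definition subst_vert : finType := (f + {q : Q & F q})%type.

(* Representative of a vertex of f after identification of each q-labelled
   vertex with the root of the copy of F q. *)
Definition subst_repr (a : f) : subst_vert :=
  if var_in Q (lab a) is Some q then inr (Tagged (fun q => F q) (root (F q)))
  else inl a.

Definition subst_lab (u : subst_vert) : label X :=
  match u with
  | inl a => lab a
  | inr v => lab (tagged v)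
  end.

Definition subst_succ (u : subst_vert) : seq subst_vert :=
  match u with
  | inl a => map subst_repr (succ a)
  | inr v => [seq inr (Tagged (fun q => F q) b) | b <- succ (tagged v)]
  end.

Lemma subst_size_succ u : size (subst_succ u) = arity (subst_lab u).
Proof. by case: u => [a|v]; rewrite /= size_map size_succ. Qed.

Definition subst_ugraph : ugraph X := UGraph subst_size_succ.

Lemma subst_guarded : guarded subst_ugraph.
Proof.
have right_edge (q : Q) (b : F q) (u : subst_ugraph) :
    edge (inr (Tagged (fun q => F q) b) : subst_ugraph) u ->
    exists2 b' : F q, u = inr (Tagged (fun q => F q) b') & edge b b'.
  by case/mapP=> b' bb' ->; exists b'.
have right_conn (q : Q) (b : F q) (u : subst_ugraph) :
    connect (@bf X subst_ugraph) (inr (Tagged (fun q => F q) b)) u ->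
    exists2 b' : F q, u = inr (Tagged (fun q => F q) b')
       & connect (@bf X (F q)) b b'.
  case/connectP=> p pp ->; elim: p b pp => [|v p IHp] b /=.
    by move=> _; exists b.
  case/andP=> /and3P[bb bv /right_edge[b' dv ebb']]; subst v.
  move=> /IHp[b'' -> cb]; exists b'' => //.
  by apply: connect_trans (connect1 _) cb; apply/and3P.
have left_conn (u : subst_ugraph) (a : f) :
    connect (@bf X subst_ugraph) u (inl a) ->
    exists2 a' : f, u = inl a' & connect (@bf X f) a' a.
  case/connectP=> p; elim: p u => [|v p IHp] u /=.
    by move=> _ <-; exists a.
  move=> /andP[uv pp] la; have [a' dv ca] := IHp _ pp la; subst v.
  case: u uv => [c|[q b]] /and3P[bu bv euv].
    exists c => //; case/mapP: euv => d cd; rewrite /subst_repr.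
    case: (var_in Q _) => [//|[da]]; subst d.
    by apply: connect_trans (connect1 _) ca; apply/and3P.
  by case/right_edge: euv.
apply/guardedP=> [[a|[q b]]] v.
  move=> ab /left_conn[a' dv ca']; subst v.
  case/and3P: ab => ba bb /mapP[d ad]; rewrite /subst_repr.
  case: (var_in Q _) => [//|[da]]; subst d.
  by have /guardedP/(_ a a') := @formula_guarded _ f; apply=> //; apply/and3P.
case/and3P=> ba bb /right_edge[b' dv bb']; subst v.
case/right_conn=> b'' [] /eqP; rewrite eq_Tagged => /eqP /= <- cb.
by have /guardedP/(_ b b') := @formula_guarded _ (F q); apply=> //; apply/and3P.
Qed.

(* Taking the generated subgraph removes the vertices of f labelled by a
   variable of Q (superseded by their representatives) and the copies of those
   F q such that q does not occur in f. *)
Definition subst : formula X :=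
  Formula (@gen_guarded X subst_ugraph (subst_repr (root f)) subst_guarded).

End Substitution.

Definition system (X : choiceType) (Q : {fset X}) : Type := Q -> formula X.

(* Edge relation of the dependency graph of E on Q. *)
Definition dep (X : choiceType) (Q : {fset X}) (E : system Q) (q q' : Q) :
    Prop :=
  ~ modalised_in (E q) (val q').

Definition modalised_system (X : choiceType) (Q : {fset X}) (E : system Q) :
    Prop :=
  acyclic (dep E).

(* Edge relation of the subgraph of dep in which the occurrence of q' is at the
   root. *)
Definition dep0 (X : choiceType) (Q : {fset X}) (E : system Q) : rel Q :=
  fun q q' => var_in Q (lab (root (E q))) == Some q'.

(* Each q has at most one dep0-successor, hence at most one maximal path; the
   default value q is not used when dep0 is acyclic, see [endpP]. *)
Definition endp (X : choiceType) (Q : {fset X}) (E : system Q) (q : Q) : Q :=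
  odflt q
    [pick q' | connect (dep0 E) q q' && ~~ [exists q'', dep0 E q' q'']].

Definition is_solution (X : choiceType) (Q : {fset X}) (E : system Q)
    (F : Q -> formula X) : Prop :=
  forall q : Q,
    bisimilar (F q) (subst (E q) F) /\
    forall (q' : Q) (a : F q), lab a <> Var (val q').

Lemma var_inP (X : choiceType) (Q : {fset X}) (l : label X) (q : Q) :
  var_in Q l = Some q -> l = Var (val q).
Proof.
by case: l => //= p; rewrite /var_in /=; case: insubP => // u _ <- [->].
Qed.

Lemma bf_dep (X : choiceType) (Q : {fset X}) (E : system Q) (q q' : Q)
    (a : E q) :
  ~~ is_box (lab (root (E q))) -> connect (@bf X (E q)) (root (E q)) a ->
  var_in Q (lab a) = Some q' -> dep E q q'.
Proof.
move=> b0 /connectP[p pp la] /var_inP av md.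
have [] := @negP _ (_ : ~~ has (fun a => is_box (lab a)) (root (E q) :: p)).
  elim: p (root _) b0 pp {md la} => [|b p IHp] r b0 /=; first by rewrite orbF.
  by rewrite negb_or b0; case/andP=> /and3P[_ b1 _] /(IHp _ b1).
apply: md; rewrite -?la //.
by apply: sub_path pp => x y /and3P[].
Qed.

Lemma dep0_dep (X : choiceType) (Q : {fset X}) (E : system Q) (q q' : Q) :
  dep0 E q q' -> dep E q q'.
Proof.
by move=> /eqP h; apply: (bf_dep _ _ h) => //; rewrite (var_inP h).
Qed.

Lemma modalised_no_loop (X : choiceType) (Q : {fset X}) (E : system Q)
    (e : rel Q) :
  modalised_system E -> (forall q q', e q q' -> dep E q q') ->
  forall q q', e q q' -> ~ connect e q' q.
Proof.
move=> hE he q q' eqq' /connectP[p0].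
case/shortenP=> p pp Up _ lq; apply: (hE (q' :: p)); split=> // x xp; apply: he.
by apply: next_cycle xp; rewrite /= rcons_path pp -lq.
Qed.

Section Solution.
Context (X : choiceType) (Q : {fset X}) (E : system Q).
Context (hE : modalised_system E).

Lemma endpP q :
  connect (dep0 E) q (endp E q) /\ var_in Q (lab (root (E (endp E q)))) = None.
Proof.
have nl := modalised_no_loop hE (@dep0_dep _ _ E).
suff [q' qq' nq'] : exists2 q', connect (dep0 E) q q' &
    var_in Q (lab (root (E q'))) = None.
  rewrite /endp; case: pickP => [u /andP[cu nu]|/(_ q')] /=.
    split=> //; case h: (var_in _ _) => [v|] //.
    by case/existsP: nu; exists v; rewrite /dep0 h.
  rewrite qq' /= => /negbT; rewrite negbK => /existsP[v].
  by rewrite /dep0 nq'.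
have [n] := ubnP #|connect (dep0 E) q|; elim: n q => // n IHn q.
rewrite ltnS => le_n; case h: (var_in Q (lab (root (E q)))) => [v|]; last first.
  by exists q.
have qv : dep0 E q v by rewrite /dep0 h.
case: (IHn v) => [|q' cq nq].
  apply: leq_trans le_n; apply/proper_card/properP; split.
    by apply/subsetP => x; rewrite !inE; apply: connect_trans (connect1 qv).
  exists q; rewrite !inE ?connect0 //; apply/negP; exact: nl.
by exists q' => //; apply: connect_trans (connect1 qv) cq.
Qed.

Definition psi_vert : finType :=
  {u : {q : Q & E q} | var_in Q (lab (tagged u)) == None}.

Definition psi_pair (q : Q) (a : E q) : {q : Q & E q} :=
  Tagged (fun q => E q) a.

Lemma psi_end_subproof q :
  var_in Q (lab (tagged (psi_pair (root (E (endp E q)))))) == None.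
Proof. by have [_ ->] := endpP q. Qed.

Definition psi_end (q : Q) : psi_vert :=
  exist _ (psi_pair (root (E (endp E q)))) (psi_end_subproof q).

(* In the second branch the label of a is not in Q, so [insubd] returns the
   pair (q, a) itself, not its default value. *)
Definition idfy (q : Q) (a : E q) : psi_vert :=
  if var_in Q (lab a) is Some q' then psi_end q'
  else insubd (psi_end q) (psi_pair a).

Lemma val_idfy_None q (a : E q) :
  var_in Q (lab a) = None -> val (idfy a) = psi_pair a.
Proof. by move=> h; rewrite /idfy h val_insubd /= h. Qed.

Definition psi_lab (u : psi_vert) : label X := lab (tagged (val u)).

Definition psi_succ (u : psi_vert) : seq psi_vert :=
  [seq idfy b | b <- succ (tagged (val u))].

Lemma psi_size_succ u : size (psi_succ u) = arity (psi_lab u).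
Proof. by rewrite size_map size_succ. Qed.

Definition psi : ugraph X := UGraph psi_size_succ.

Lemma psi_guarded : guarded psi.
Proof.
pose e : rel Q := fun q q' => ~~ is_box (lab (root (E q))) &&
  [exists a : E q, connect (@bf X (E q)) (root (E q)) a
                   && (var_in Q (lab a) == Some q')].
have e_dep q q' : e q q' -> dep E q q'.
  by case/andP=> b0 /existsP[a /andP[ca /eqP]]; apply: bf_dep.
have end_e q : connect e q (endp E q).
  have [cq _] := endpP q; apply: connect_sub cq => x y h; apply: connect1.
  have/eqP hx := h; rewrite /e (var_inP hx) /=; apply/existsP.
  by exists (root (E x)); rewrite connect0.
have nl := modalised_no_loop hE e_dep.
pose nojump (u w : psi_vert) := exists q (a b : E q),
  [/\ val u = psi_pair a, val w = psi_pair b & connect (@bf X (E q)) a b].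
pose nojump1 (u w : psi_vert) := exists q (a b : E q),
  [/\ val u = psi_pair a, val w = psi_pair b &
   exists2 c, bf a c & connect (@bf X (E q)) c b].
pose jump (u w : psi_vert) := exists q (a : E q) r q' (b : E q'),
  [/\ val u = psi_pair a, val w = psi_pair b,
   exists2 c, connect (@bf X (E q)) a c & var_in Q (lab c) = Some r,
   connect e r q' & ~~ is_box (lab (root (E q'))) /\
   connect (@bf X (E q')) (root (E q')) b].
have step u v w : @bf X psi u v -> nojump v w \/ jump v w ->
    nojump1 u w \/ jump u w.
  have [[q a] du] : exists x, val u = x by exists (val u).
  case/and3P; rewrite /= {1}/psi_lab du /= => ba bv.
  rewrite /edge /= /psi_succ du => /mapP[/= c ac dv].
  case hc: (var_in Q (lab c)) => [r|]; last first.
    have dv' : val v = psi_pair c by rewrite dv val_idfy_None.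
    have bac : bf a c.
      by apply/and3P; split=> //; move: bv; rewrite /psi_lab dv'.
    case=> [[q1 [a1 [b1 [e1 ew cb]]]]|[q1 [a1 [r [q' [b [e1 ew [d cd hd] cr cb]]]]]]].
      move: e1; rewrite dv' => e1; have dq : q = q1 by case: e1.
      subst q1; move/eqP: e1; rewrite /psi_pair eq_Tagged => /eqP /= e1.
      by subst a1; left; exists q, a, b1; split=> //; exists c.
    move: e1; rewrite dv' => e1; have dq : q = q1 by case: e1.
    subst q1; move/eqP: e1; rewrite /psi_pair eq_Tagged => /eqP /= e1.
    subst a1; right; exists q, a, r, q', b; split=> //; exists d => //.
    by apply: connect_trans (connect1 _) cd.
  have dv' : val v = psi_pair (root (E (endp E r))) by rewrite dv /idfy hc.
  have br : ~~ is_box (lab (root (E (endp E r)))).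
    by move: bv; rewrite /psi_lab dv'.
  have cac : connect (@bf X (E q)) a c.
    by apply: connect1; apply/and3P; split=> //; rewrite (var_inP hc).
  case=> [[q1 [a1 [b1 [e1 ew cb]]]]|[q1 [a1 [r' [q' [b [e1 ew [d cd hd] cr cb]]]]]]].
    move: e1; rewrite dv' => e1; have dq : endp E r = q1 by case: e1.
    subst q1; move/eqP: e1; rewrite /psi_pair eq_Tagged => /eqP /= e1.
    subst a1; right; exists q, a, r, (endp E r), b1; split=> //.
    by exists c.
  move: e1; rewrite dv' => e1; have dq : endp E r = q1 by case: e1.
  subst q1; move/eqP: e1; rewrite /psi_pair eq_Tagged => /eqP /= e1.
  subst a1; right; exists q, a, r, q', b; split=> //; first by exists c.
  apply: connect_trans (end_e r) (connect_trans (connect1 _) cr).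
  by rewrite /e br; apply/existsP; exists d; rewrite cd hd eqxx.
have reach u w : connect (@bf X psi) u w -> nojump u w \/ jump u w.
  case/connectP=> p; elim: p u => [|v p IHp] u /=.
    by move=> _ ->; left; case du: (val u) => [q a]; exists q, a, a.
  case/andP=> uv pp lw; case: (step u v w uv (IHp _ pp lw)); last by right.
  case=> q [a [b [eu ew [c ac cb]]]]; left; exists q, a, b; split=> //.
  exact: connect_trans (connect1 ac) cb.
apply/guardedP=> u v uv /reach /(step _ _ _ uv).
case=> [[q [a [b [-> e1 [c ac]]]]]|[q [a [r [q' [b [-> e1 [c ac hc] crq [b0 cb]]]]]]]].
  move/eqP: e1; rewrite /psi_pair eq_Tagged => /eqP /= <-.
  by have /guardedP/(_ a c ac) := @formula_guarded _ (E q).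
have dq : q = q' by case: e1.
subst q'; move/eqP: e1; rewrite /psi_pair eq_Tagged => /eqP /= e1.
subst b; apply: (nl q r) => //.
rewrite /e b0; apply/existsP; exists c.
by rewrite (connect_trans cb ac) hc eqxx.
Qed.

Definition digamma (q : Q) : formula X :=
  Formula (@gen_guarded X psi (idfy (root (E q))) psi_guarded).

End Solution.

(* Main.v *)
(* The map sending a vertex [a] of [phi_q] to [idfy a], and a vertex of a copy
   of [digamma q'] to itself, commutes with labels and successors on the
   vertices of [phi_q F] that survive the identification.  The point to check
   is that a vertex labelled [q'], replaced by the root [idfy (root phi_q')] in
   [phi_q F], is redirected to the root of [phi_(end q')] in [Psi]: these agree
   because maximal paths of the root-dependency graph have unique endpoints. *)
From mathcomp Require Import all_boot finmap.
Require Import Defs.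

Set Implicit Arguments.
Unset Strict Implicit.
Unset Printing Implicit Defensive.

(** Lets the bisimulation be built on the whole graphs: [val] carries the successor list of a
    generated subgraph to that of the full graph. *)
Lemma bisimulation_gen (X : Type) (G H : ugraph X) (r : G) (s : H)
    (R : G -> H -> Prop) :
  bisimulation R ->
  bisimulation (fun (a : gen r) (b : gen s) => R (val a) (val b)).
Proof.
move=> bR a b /bR[lab_ab succ_ab]; split=> // i i_lt.
have i_lta : i < size (gen_succ a) by rewrite gen_size_succ.
have i_ltb : i < size (gen_succ b) by rewrite gen_size_succ -lab_ab.
have := succ_ab i i_lt; rewrite -!map_gen_succ.
by rewrite (nth_map a) // (nth_map b).
Qed.

Lemma var_in_val (X : choiceType) (Q : {fset X}) (q : Q) :
  var_in Q (Var (val q)) = Some q.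
Proof. by rewrite /var_in /= valK. Qed.

Lemma dep0_end_unique (X : choiceType) (Q : {fset X}) (E : system Q)
    (q x y : Q) :
  connect (dep0 E) q x -> var_in Q (lab (root (E x))) = None ->
  connect (dep0 E) q y -> var_in Q (lab (root (E y))) = None -> x = y.
Proof.
case/connectP=> p; elim: p q => [|q1 p IHp] q /=.
  move=> _ -> q_end /connectP[[|q2 p] //=].
  by rewrite /dep0 q_end.
case/andP=> /eqP q_q1 q1p x_p x_end /connectP[[|q2 p'] /=].
  by move=> _ ->; rewrite q_q1.
(* A vertex has at most one [dep0]-successor, so both paths start with the same step. *)
case/andP; rewrite /dep0 q_q1 => /eqP[<-] q1p' y_p' y_end.
by apply: (IHp q1) => //; apply/connectP; exists p'.
Qed.

Section Solution.
Context (X : choiceType) (Q : {fset X}) (E : system Q).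
Context (hE : modalised_system E).

Lemma endp_eq (q x : Q) :
  connect (dep0 E) q x -> var_in Q (lab (root (E x))) = None -> endp E q = x.
Proof.
have [q_end end_end] := endpP hE q.
exact: dep0_end_unique q_end end_end.
Qed.

(** If the root is labelled [q'] in [Q], then [q] and [q'] have the same endpoint; otherwise [q] is
    its own endpoint. *)
Lemma idfy_root (q : Q) : idfy hE (root (E q)) = psi_end hE q.
Proof.
apply: val_inj; case q_root: (var_in Q (lab (root (E q)))) => [q'|].
  rewrite /idfy q_root /=; have [q'_end end_end] := endpP hE q'.
  rewrite (endp_eq (connect_trans (connect1 _) q'_end)) //.
  by rewrite /dep0 q_root.
by rewrite val_idfy_None //= (endp_eq (connect0 _ q)).
Qed.

Context (q : Q).
Let F := digamma hE.

Definition psi_of_subst (u : subst_ugraph (E q) F) : psi hE :=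
  match u with
  | inl a => idfy hE a
  | inr v => val (tagged v)
  end.

(* The unmerged vertices: [subst_ugraph] still contains the vertices of [E q]
   labelled by a variable of Q. *)
Definition subst_good (u : subst_ugraph (E q) F) : bool :=
  if u is inl a then var_in Q (lab a) == None else true.

Lemma psi_of_subst_repr (a : E q) :
  psi_of_subst (subst_repr F a) = idfy hE a.
Proof.
rewrite /subst_repr; case a_var: (var_in Q (lab a)) => [q'|] //=.
by rewrite idfy_root /idfy a_var.
Qed.

Lemma subst_good_repr (a : E q) : subst_good (subst_repr F a).
Proof.
by rewrite /subst_repr; case a_var: (var_in Q (lab a)) => [q'|] //=; apply/eqP.
Qed.

Lemma lab_psi_of_subst u : subst_good u -> lab (psi_of_subst u) = lab u.
Proof.
case: u => [a /eqP a_var|//].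
by rewrite /= /psi_lab val_idfy_None.
Qed.

Lemma succ_psi_of_subst u : subst_good u ->
  succ (psi_of_subst u) = map psi_of_subst (succ u).
Proof.
case: u => [a /eqP a_var|[q' b] _].
  rewrite /= /psi_succ val_idfy_None //= -map_comp.
  by apply: eq_map => b; rewrite /= psi_of_subst_repr.
by rewrite /= -map_comp; apply: esym (map_gen_succ b).
Qed.

(** Successors of vertices of [E q] pass through [subst_repr], which never returns a merged
    vertex. *)
Lemma succ_subst_good u v : v \in succ u -> subst_good v.
Proof.
case: u => [a /mapP[b _ ->]|w /mapP[b _ ->] //].
exact: subst_good_repr.
Qed.

(** The graph of [psi_of_subst] is cut down to good vertices because on a vertex labelled in [Q]
    that map changes the label. *)
Lemma bisimulation_psi_of_subst :
  bisimulation (fun (x : psi hE) u => x = psi_of_subst u /\ subst_good u).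
Proof.
move=> x u [-> u_good]; split=> [|i]; first exact: lab_psi_of_subst.
rewrite lab_psi_of_subst // -size_succ => i_lt.
rewrite succ_psi_of_subst // (nth_map u) //; split=> //.
by apply: (@succ_subst_good u); apply: mem_nth.
Qed.

Lemma digamma_bisimilar_subst : bisimilar (F q) (subst (E q) F).
Proof.
exists (fun a b => val a = psi_of_subst (val b) /\ subst_good (val b)).
  exact: bisimulation_gen bisimulation_psi_of_subst.
by rewrite /= psi_of_subst_repr subst_good_repr.
Qed.

(** The type [psi_vert] already excludes vertices labelled in [Q]. *)
Lemma digamma_lab (q' : Q) (a : F q) : lab a <> Var (val q').
Proof.
move=> a_q'; have /eqP := valP (val a).
by move: a_q'; rewrite /= /psi_lab => ->; rewrite var_in_val.
Qed.

End Solution.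

Theorem theorem2p15 (X : choiceType) (Q : {fset X}) (E : system Q)
    (hE : modalised_system E) :
  is_solution E (fun q : Q => digamma hE q).
Proof.
move=> q; split; first exact: digamma_bisimilar_subst.
exact: digamma_lab.
Qed.
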